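(* Let $d\ge 1$. Then $$\mathcal{P}_{d}(z,t)=\sum_{0\leq k <d/2} \psi_{d-2k} \left( \frac{(-1)^k t^{k(k+1)} (1-t^2)}{(t^2;t^2)_k\,(t^2;t^2)_{d-k}} \right) \frac{1}{1-z t^{d-2k}},$$ where the argument of $\psi_{d-2k}$ is expanded as a formal power series in $t$.
   Context: $V_d$ denotes the complex vector space of binary forms of degree $d$, with the natural action of $G=SL(2,\mathbb{C})$. The algebra of covariants is $\mathcal{C}_d=\mathbb{C}[V_d\oplus\mathbb{C}^2]^{G}$, bigraded so that $(\mathcal{C}_d)_{i,j}$ is the space of invariants homogeneous of degree $i$ in the coordinates of $V_d$ and of degree $j$ in the coordinates of $\mathbb{C}^2$. Its bivariate Poincaré series is $\mathcal{P}_d(z,t)=\sum_{i,j\ge 0}\dim((\mathcal{C}_d)_{i,j})\,z^it^j$. $(a;q)_n=(1-a)(1-aq)\cdots(1-aq^{n-1})$ is the $q$-shifted factorial, with $(a;q)_0=1$. For a positive integer $n$, $\psi_n:\mathbb{C}[[t]]\to\mathbb{C}[[z,t]]$ is the linear map (extended termwise to power series) defined by $\psi_n(t^m)=z^it^j$ where $i\ge 0$ and $0\le j<n$ are the unique integers with $m=ni-j$. *)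

(* Defs.v *)
From mathcomp Require Import all_boot all_algebra.
From mathcomp Require Import Rstruct.
From mathcomp.real_closed Require Import complex.
From mathcomp Require Import mpoly.

Unset Printing Implicit Defensive.
Import GRing.Theory.
Local Open Scope ring_scope.

Definition C : numClosedFieldType := complex Rdefinitions.R.

(* V_d is the space of binary forms of degree d, i.e. the d-homogeneous
   elements f of {mpoly C[2]} (variables 'X_0 = x, 'X_1 = y).
   Coordinates on V_d: a_k(f) = coefficient of x^(d-k) y^k, 0 <= k <= d. *)
Definition mon (d k : nat) : 'X_{1..2} :=
  [multinom (if (i == 0 :> nat) then (d - k)%N else k) | i < 2].

Definition inv_subst (g : 'M[C]_2) : 2.-tuple {mpoly C[2]} :=
  [tuple \sum_(s < 2) (invmx g) r s *: 'X_s | r < 2].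

Definition act_form (g : 'M[C]_2) (f : {mpoly C[2]}) : {mpoly C[2]} :=
  f \mPo inv_subst g.

(* The point (f, u) of V_d (+) C^2 written in the coordinates
   (a_0, ..., a_d, u_1, u_2), indexed by 'I_(d+3). *)
Definition pt (d : nat) (f : {mpoly C[2]}) (u : 'cV[C]_2) : 'I_d.+3 -> C :=
  fun k => if (k < d.+1)%N then f@_(mon d k)
           else if (k == d.+1 :> nat) then u 0 0 else u 1 0.

Definition is_invariant (d : nat) (P : {mpoly C[d.+3]}) : Prop :=
  forall g : 'M[C]_2, \det g = 1 ->
  forall f : {mpoly C[2]}, f \is d.-homog ->
  forall u : 'cV[C]_2,
    meval (pt d (act_form g f) (g *m u)) P = meval (pt d f u) P.

Definition bihomog (d i j : nat) (P : {mpoly C[d.+3]}) : Prop :=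
  forall m, m \in msupp P ->
    (\sum_(k < d.+3 | (k < d.+1)%N) m k)%N = i /\
    (\sum_(k < d.+3 | (d.+1 <= k)%N) m k)%N = j.

Definition in_cov (d i j : nat) (P : {mpoly C[d.+3]}) : Prop :=
  bihomog d i j P /\ is_invariant d P.

Definition has_basis (n : nat) (S : {mpoly C[n]} -> Prop) (N : nat) : Prop :=
  exists B : 'I_N -> {mpoly C[n]},
    [/\ forall k, S (B k),
        forall c : 'I_N -> C, \sum_(k < N) c k *: B k = 0 -> forall k, c k = 0
      & forall P, S P -> exists c : 'I_N -> C, P = \sum_(k < N) c k *: B k].

Definition dim_cov (d i j N : nat) : Prop := @has_basis d.+3 (in_cov d i j) N.

(* univariate series in t: m |-> coefficient of t^m *)
Definition ps := nat -> int.
Definition ps_one : ps := fun m => if m == 0%N then 1 else 0.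
Definition ps_mul (a b : ps) : ps :=
  fun m => \sum_(l < m.+1) a l * b (m - l)%N.
(* expansion of 1/(1 - t^s), s >= 1 *)
Definition ps_geom (s : nat) : ps := fun m => if (s %| m)%N then 1 else 0.
Definition ps_inv_qpoch (n : nat) : ps :=
  foldr (fun r acc => ps_mul (ps_geom r.*2) acc) ps_one (iota 1 n).
Definition ps_1mt2 : ps :=
  fun m => if m == 0%N then 1 else if m == 2%N then -1 else 0.
Definition ps_F (d k : nat) : ps :=
  fun m => if (k * k.+1 <= m)%N then
             (-1) ^+ k * ps_mul ps_1mt2 (ps_mul (ps_inv_qpoch k)
                                          (ps_inv_qpoch (d - k))) (m - k * k.+1)%N
           else 0.

(* bivariate series in z,t: (i,j) |-> coefficient of z^i t^j *)
Definition bps := nat -> nat -> int.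
Definition bps_mul (A B : bps) : bps :=
  fun i j => \sum_(a < i.+1) \sum_(b < j.+1) A a b * B (i - a)%N (j - b)%N.
(* expansion of 1/(1 - z t^n) *)
Definition bps_geom (n : nat) : bps := fun i j => if j == (n * i)%N then 1 else 0.

(* psi_n : t^m |-> z^i t^j with m = n i - j, 0 <= j < n, extended termwise:
   the coefficient of z^i t^j in psi_n(F) is F_{n i - j} when 0 <= j < n and
   n i - j >= 0, and 0 otherwise. *)
Definition psi (n : nat) (F : ps) : bps :=
  fun i j => if (j < n)%N && (j <= n * i)%N then F (n * i - j)%N else 0.

Definition rhs (d i j : nat) : int :=
  \sum_(k < d | (2 * k < d)%N)
     bps_mul (psi (d - 2 * k) (ps_F d k)) (bps_geom (d - 2 * k)) i j.

(* Main.v *)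
Require Import Defs.
From HB Require Import structures.
From mathcomp Require Import all_boot all_order all_algebra.
From mathcomp Require Import zify ring.
From mathcomp Require Import Rstruct.
From mathcomp.real_closed Require Import complex.
From mathcomp Require Import mpoly.
Set Implicit Arguments.
Unset Strict Implicit.
Unset Printing Implicit Defensive.
Import Order.TTheory GRing.Theory Num.Theory.
Local Open Scope ring_scope.

(* Coordinates on V_d + C^2 are differentiated along the two root subgroups of SL(2):
   a polynomial is invariant iff it is killed by the two derivations E and F, and for
   polynomials of bidegree (i,j) this holds iff it has weight 0 and is killed by E.
   Since E maps weight 0 onto weight 2 (because E F is injective on weight 2), the
   dimension sought is the number of monomials of bidegree (i,j) and weight 0 minus the
   number of those of weight 2. Summing over the exponent of u_1, this telescopes to the
   difference of two consecutive coefficients of a Gaussian polynomial (Cayley-Sylvester),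
   and expanding the numerator of that polynomial by the q-binomial theorem with q = t^2
   gives the terms of the right-hand side. The operator psi_n followed by multiplication
   by 1/(1 - z t^n) has z^i t^j-coefficient F_(n i - j). *)

(** * Gaussian polynomials and the right-hand side *)

(** Extension by zero to negative exponents, so that shifts [x - s] can be taken in [int] without
    truncation. *)
Definition ps_ext (f : ps) (x : int) : int := if x is Posz m then f m else 0.

Lemma ps_ext_lt0 f x : x < 0 -> ps_ext f x = 0.
Proof. by case: x. Qed.

Lemma ps_mulC a b m : ps_mul a b m = ps_mul b a m.
Proof.
rewrite /ps_mul (reindex_inj rev_ord_inj) /=; apply: eq_bigr => l _.
by rewrite mulrC subSS subKn // -ltnS.
Qed.

(** Any bound [M] beyond [x] serves as the range, so the values at [x] and at [x - s] become sums
    over one range and subtract termwise. *)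
Lemma ps_ext_mul a b x (M : nat) : x < M%:Z ->
  ps_ext (ps_mul a b) x = \sum_(l < M) b l * ps_ext a (x - l%:Z).
Proof.
case: x => m hm; last by rewrite big1 // => l _; rewrite ps_ext_lt0 ?mulr0 //; lia.
rewrite /= ps_mulC /ps_mul.
rewrite (big_ord_widen M (fun l => b l * a (m - l)%N)) //.
rewrite big_mkcond /=; apply: eq_bigr => l _; case: ifP => hl.
  by rewrite subzn // -ltnS.
by rewrite ps_ext_lt0 ?mulr0 //; lia.
Qed.

Lemma ps_ext_mulC a b x : ps_ext (ps_mul a b) x = ps_ext (ps_mul b a) x.
Proof. by case: x => //= m; rewrite ps_mulC. Qed.

(* In terms of series: (1 - t^s) a = a' implies (1 - t^s) a b = a' b. *)
Lemma ps_mul_shift a a' b (s : nat) :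
  (forall x, ps_ext a x - ps_ext a (x - s%:Z) = ps_ext a' x) ->
  forall x, ps_ext (ps_mul a b) x - ps_ext (ps_mul a b) (x - s%:Z) =
            ps_ext (ps_mul a' b) x.
Proof.
move=> h x; have hx : x < `|x|.+1%:Z by lia.
have hxs : x - s%:Z < `|x|.+1%:Z by lia.
rewrite !(ps_ext_mul _ _ hx) (ps_ext_mul _ _ hxs) -sumrB; apply: eq_bigr => l _.
by rewrite -mulrBr -h addrAC.
Qed.

Lemma ps_mul_shiftr a b b' (s : nat) :
  (forall x, ps_ext b x - ps_ext b (x - s%:Z) = ps_ext b' x) ->
  forall x, ps_ext (ps_mul a b) x - ps_ext (ps_mul a b) (x - s%:Z) =
            ps_ext (ps_mul a b') x.
Proof. by move=> h x; rewrite !(ps_ext_mulC a); apply: ps_mul_shift. Qed.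

Lemma ps_geom_shift s : (0 < s)%N ->
  forall x, ps_ext (ps_geom s) x - ps_ext (ps_geom s) (x - s%:Z) = ps_ext ps_one x.
Proof.
move=> s0 [m|m]; last by rewrite !ps_ext_lt0 //; lia.
case: (leqP s m) => hm.
  rewrite subzn //= /ps_geom /ps_one (dvdn_subl hm) //.
  by rewrite subrr; case: m hm => // hm; move: s0; rewrite ltnNge hm.
rewrite (ps_ext_lt0 _ (_ : m%:Z - s%:Z < 0)) ?subr0; last by lia.
rewrite /= /ps_geom /ps_one; case: m hm => [|m] hm; first by rewrite dvdn0.
by rewrite gtnNdvd.
Qed.

Lemma ps_mul1 a x : ps_ext (ps_mul ps_one a) x = ps_ext a x.
Proof.
case: x => //= m; rewrite /ps_mul big_ord_recl /= big1 ?addr0 ?mul1r ?subn0 //.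
by move=> i _; rewrite /ps_one /= mul0r.
Qed.

Lemma ps_inv_qpoch_rec n x :
  ps_ext (ps_inv_qpoch n.+1) x - ps_ext (ps_inv_qpoch n.+1) (x - (n.+1).*2%:Z)
  = ps_ext (ps_inv_qpoch n) x.
Proof.
(* The new factor sits innermost in the fold; [ps_mul_shiftr] then carries the shift through the
   outer factors. *)
have -> : ps_inv_qpoch n.+1 = foldr (fun r acc => ps_mul (ps_geom r.*2) acc)
    (ps_mul (ps_geom (n.+1).*2) ps_one) (iota 1 n).
  rewrite /ps_inv_qpoch (_ : iota 1 n.+1 = iota 1 n ++ [:: n.+1]) ?foldr_cat //.
  by rewrite -{1}(addn1 n) iotaD add1n.
rewrite /ps_inv_qpoch.
elim: (iota 1 n) x => [|r l IHl] x /=; last exact: ps_mul_shiftr.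
rewrite (@ps_mul_shift _ ps_one) ?ps_mul1 //.
exact: ps_geom_shift.
Qed.

Definition qterm (d k : nat) (x : int) : int :=
  ps_ext (ps_mul (ps_inv_qpoch k) (ps_inv_qpoch (d - k))) x.

Lemma qterm_lt0 d k x : x < 0 -> qterm d k x = 0.
Proof. exact: ps_ext_lt0. Qed.

Lemma qterm_recr d k x : (k <= d)%N ->
  qterm d.+1 k x - qterm d.+1 k (x - 2 * (d%:Z + 1 - k%:Z)) = qterm d k x.
Proof.
move=> kd; rewrite /qterm subSn //.
have -> : 2 * (d%:Z + 1 - k%:Z) = (d - k).+1.*2%:Z by lia.
by apply: ps_mul_shiftr => y; rewrite ps_inv_qpoch_rec.
Qed.

Lemma qterm_recl d k x :
  qterm d.+1 k.+1 x - qterm d.+1 k.+1 (x - 2 * (k%:Z + 1)) = qterm d k x.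
Proof.
rewrite /qterm subSS.
have -> : 2 * (k%:Z + 1) = k.+1.*2%:Z by lia.
by apply: ps_mul_shift => y; rewrite ps_inv_qpoch_rec.
Qed.

(* Coefficient of t^x in the expansion, by the q-binomial theorem with q = t^2, of
   the Gaussian polynomial [d + i - 1, d]; the exponent of the k-th term is
   k(k-1) + 2ik. *)
Definition gauss (d i : nat) (x : int) : int :=
  \sum_(k < d.+1) (-1) ^+ k *
     qterm d k (x - k%:Z * (k%:Z - 1) - 2 * i%:Z * k%:Z).

Lemma gauss_lt0 d i x : x < 0 -> gauss d i x = 0.
Proof.
move=> x0; rewrite /gauss big1 // => k _; rewrite qterm_lt0 ?mulr0 //.
have : 0 <= (k : nat)%:Z * ((k : nat)%:Z - 1) by case: (k : nat) => [|l]; nia.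
have : 0 <= 2 * i%:Z * (k : nat)%:Z by lia.
lia.
Qed.

(** The q-Pascal rule [n+1, m+1] = [n, m] + q^(m+1) [n, m+1] with n = d + i, m = d. It holds term by
    term through [qterm_recr]; the two terms of index d + 1 cancel. *)
Lemma gauss_recd d i x :
  gauss d.+1 i.+1 x = gauss d i.+1 x + gauss d.+1 i (x - 2 * (d%:Z + 1)).
Proof.
apply/eqP; rewrite -subr_eq; apply/eqP.
rewrite /gauss -sumrB big_ord_recr /= [X in _ + X](_ : _ = 0) ?addr0; last first.
  by apply/eqP; rewrite subr_eq0; apply/eqP; congr (_ * qterm _ _ _); lia.
apply: eq_bigr => k _; rewrite -mulrBr -[in RHS](qterm_recr _ (leq_ord k)).
by congr (_ * (_ - qterm _ _ _)); lia.
Qed.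

(** The other q-Pascal rule, [n+1, m+1] = [n, m+1] + q^(n-m) [n, m]. Here the terms of index 0
    cancel, and [qterm_recl] matches index k + 1 with index k of the smaller sum. *)
Lemma gauss_reci d i x :
  gauss d.+1 i.+1 x = gauss d.+1 i x + gauss d i.+1 (x - 2 * i%:Z).
Proof.
apply/eqP; rewrite addrC -subr_eq; apply/eqP.
rewrite /gauss -sumrB big_ord_recl /= [X in X + _](_ : _ = 0) ?add0r; last first.
  by apply/eqP; rewrite subr_eq0; apply/eqP; congr (_ * qterm _ _ _); lia.
apply: eq_bigr => k _.
rewrite /bump /= add1n -mulrBr exprS mulN1r mulNr -mulrN opprB -[in RHS](qterm_recl d).
congr (_ * (qterm _ _ _ - qterm _ _ _)); lia.
Qed.

(** Comparing both Pascal rules at i = 0 shows that the coefficients have period 2(d+1); they vanish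
    at negative exponents, hence everywhere. *)
Lemma gauss_S0 d x : gauss d.+1 0 x = 0.
Proof.
have h y : gauss d.+1 0 y = gauss d.+1 0 (y - 2 * (d%:Z + 1)).
  by have := gauss_recd d 0 y; have := gauss_reci d 0 y; rewrite mulr0 subr0; lia.
suff hn (n : nat) y : y < n%:Z -> gauss d.+1 0 y = 0 by apply: (hn `|x|.+1); lia.
elim: n y => [|n IHn] y hy; first exact: gauss_lt0.
by rewrite h IHn //; lia.
Qed.

Lemma gauss0 i x : gauss 0 i x = (x == 0)%:R.
Proof.
rewrite /gauss big_ord1 expr0 mul1r /qterm /= !(mul0r, mulr0, subr0).
by rewrite ps_mul1; case: x => [[|m]|m].
Qed.

Lemma gauss1 d x : gauss d 1 x = (x == 0)%:R.
Proof. by elim: d => [|d IHd]; rewrite ?gauss0 // gauss_recd IHd gauss_S0 addr0. Qed.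

(** Double induction: reflecting the exponent turns one Pascal rule into the other. *)
Lemma gauss_sym d i x : gauss d i.+1 (2 * d%:Z * i%:Z - x) = gauss d i.+1 x.
Proof.
elim: d i x => [|d IHd] i x; first by rewrite !gauss0 mulr0 mul0r sub0r oppr_eq0.
elim: i x => [|i IHi] x; first by rewrite !gauss1 mulr0 sub0r oppr_eq0.
rewrite gauss_recd (gauss_reci d i.+1 x) addrC -(IHi x) -(IHd _ (x - _)).
by congr (gauss _ _ _ + gauss _ _ _); lia.
Qed.

(** Write j = nq + r with r < n. The [psi] factor must supply t^r and the geometric factor z^q
    t^(nq), so only (a, b) = (i - q, r) contributes; for q > i both sides are zero. *)
Lemma psi_mul_geom n F i j : (0 < n)%N ->
  bps_mul (psi n F) (bps_geom n) i j = ps_ext F (n%:Z * i%:Z - j%:Z).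
Proof.
move=> n0; rewrite /bps_mul /psi /bps_geom.
have hj := divn_eq j n; have hr := ltn_pmod j n0.
have [hc|hc] := leqP (j %/ n) i; last first.
  rewrite ps_ext_lt0; last by nia.
  rewrite big1 // => a _; rewrite big1 // => b _; case: eqP => [e|_]; last by rewrite mulr0.
  have := ltn_ord b; have := ltn_ord a; case: ifP => [/andP[hb _]|]; last by rewrite mul0r.
  by move=> ha hb'; nia.
have ha : (i - j %/ n < i.+1)%N by rewrite ltnS leq_subr.
have hb : (j %% n < j.+1)%N by rewrite ltnS leq_mod.
rewrite (bigD1 (Ordinal ha)) //= (bigD1 (Ordinal hb)) //=.
rewrite [X in _ + X + _]big1 ?addr0; last first.
  move=> b /eqP neb; case: eqP => [e|_]; last by rewrite mulr0.
  case: ifP => [/andP[hbn _]|]; last by rewrite mul0r.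
  by case: neb; apply: val_inj => /=; have := ltn_ord b; nia.
rewrite [X in _ + X]big1 ?addr0; last first.
  move=> a /eqP nea; rewrite big1 // => b _; case: eqP => [e|_]; last by rewrite mulr0.
  case: ifP => [/andP[hbn _]|]; last by rewrite mul0r.
  case: nea; apply: val_inj => /=; have := ltn_ord b; have := ltn_ord a => h1 h2.
  by rewrite (_ : j %/ n = i - a)%N ?subKn //; nia.
rewrite hr subKn // (_ : (j - j %% n == n * (j %/ n))%N); last by apply/eqP; nia.
rewrite mulr1 /=; case: ifP => [h|/negbT h]; last by rewrite ps_ext_lt0 //; nia.
have -> : n%:Z * i%:Z - j%:Z = (n * (i - j %/ n) - j %% n)%N%:Z by nia.
by [].
Qed.

Lemma ps_1mt2_mul a x :
  ps_ext (ps_mul ps_1mt2 a) x = ps_ext a x - ps_ext a (x - 2).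
Proof.
rewrite -(@ps_mul_shift ps_one ps_1mt2 a 2) ?ps_mul1 // => y.
case: y => [[|[|[|m]]]|m] //; rewrite !ps_ext_lt0 //; lia.
Qed.

Lemma ps_F_ext d k x : ps_ext (ps_F d k) x =
  (-1) ^+ k * (qterm d k (x - (k * k.+1)%N%:Z) - qterm d k (x - (k * k.+1)%N%:Z - 2)).
Proof.
rewrite /qterm -ps_1mt2_mul; case: x => [m|m]; last first.
  by rewrite [ps_ext _ (_ - _)]ps_ext_lt0 ?mulr0 //; lia.
rewrite {1}/ps_ext /ps_F; case: ifP => h; first by rewrite subzn.
by rewrite ps_ext_lt0 ?mulr0 //; lia.
Qed.

(** The exponents agree because k(k+1) + 2ik = k(k-1) + 2(i+1)k; it remains to discard the terms of
    [gauss] outside 2k < d. *)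
Lemma rhsE d i j : (0 < d)%N ->
  rhs d i j = gauss d i.+1 (i%:Z * d%:Z - j%:Z) - gauss d i.+1 (i%:Z * d%:Z - j%:Z - 2).
Proof.
move=> d0; rewrite /rhs /gauss -sumrB big_ord_recr /=.
rewrite [X in _ + X](_ : _ = 0) ?addr0; last first.
  by rewrite !qterm_lt0 ?mulr0 ?subr0 //; nia.
rewrite big_mkcond /=; apply: eq_bigr => k _; rewrite -mulrBr.
case: ifP => [hk|/negbT]; last first.
  rewrite -leqNgt => hk.
  (* As 2k >= d > 0, the argument of [qterm] is at most -2k < 0. *)
  have ek : i%:Z * d%:Z - 2 * i.+1%:Z * (k : nat)%:Z <= - 2 * (k : nat)%:Z by nia.
  have hk2 : 0 <= (k : nat)%:Z * ((k : nat)%:Z - 1) by nia.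
  by rewrite !qterm_lt0 ?mulr0 ?subr0 //; lia.
rewrite psi_mul_geom ?subn_gt0 // ps_F_ext.
by congr (_ * (qterm _ _ _ - qterm _ _ _)); nia.
Qed.

(** * Monomials of given bidegree and weight *)

Lemma Posz_sum (I : Type) (r : seq I) (P : pred I) (F : I -> nat) :
  (\sum_(i <- r | P i) F i)%N%:Z = \sum_(i <- r | P i) (F i)%:Z.
Proof. by rewrite -[LHS]natz natr_sum; apply: eq_bigr => i _; rewrite natz. Qed.

(** Exponent vectors of the monomials of degree i in a_0, ..., a_d; the exponent of a_d is appended
    last, so induction on d removes that variable. *)
Fixpoint comps (d i : nat) : seq (seq nat) :=
  if d is d'.+1 then
    flatten [seq [seq rcons l c | l <- comps d' (i - c)] | c <- iota 0 i.+1]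
  else [:: [:: i]].

Lemma compsS d i : comps d.+1 i =
  flatten [seq [seq rcons l c | l <- comps d (i - c)] | c <- iota 0 i.+1].
Proof. by []. Qed.

Lemma mem_comps d i l : (l \in comps d i) = (size l == d.+1) && (sumn l == i).
Proof.
elim: d i l => [|d IHd] i l.
  rewrite inE; case: l => [|x [|y l]] //=; first by rewrite addn0 eqseq_cons eqxx andbT.
  by rewrite eqseq_cons andbF.
apply/flattenP/andP => [[_ /mapP[c hc ->] /mapP[l' hl' ->]]|[]].
  move: hl'; rewrite IHd size_rcons sumn_rcons => /andP[/eqP-> /eqP->].
  by move: hc; rewrite mem_iota add0n /= ltnS => hc; rewrite subnK.
case/lastP: l => // l c; rewrite size_rcons eqSS sumn_rcons => hs /eqP hi.
exists [seq rcons l0 c | l0 <- comps d (i - c)].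
  by apply/mapP; exists c => //; rewrite mem_iota; lia.
by apply/mapP; exists l => //; rewrite IHd hs -hi addnK /=.
Qed.

Lemma uniq_comps d i : uniq (comps d i).
Proof.
elim: d i => [|d IHd] i //; rewrite compsS.
have : uniq (iota 0 i.+1) by exact: iota_uniq.
elim: (iota _ _) => [|c s IHs] //= /andP[hc hs].
rewrite cat_uniq IHs // map_inj_uniq ?IHd //=; last by move=> l l' /rcons_inj[].
rewrite andbT; apply/hasPn => l /flattenP[_ /mapP[c' hc' ->] /mapP[l' _ ->]].
by apply/mapP => [[l'' _ /rcons_inj[_ e]]]; move: hc; rewrite -e hc'.
Qed.

Definition wsum (l : seq nat) : int := \sum_(k < size l) (k : nat)%:Z * (nth 0%N l k)%:Z.

Lemma wsum_rcons l c : wsum (rcons l c) = wsum l + (size l)%:Z * c%:Z.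
Proof.
rewrite /wsum size_rcons big_ord_recr /= nth_rcons ltnn eqxx; congr (_ + _).
by apply: eq_bigr => k _; rewrite nth_rcons ltn_ord.
Qed.

Definition ncomps (d i : nat) (x : int) : nat :=
  count (fun l => 2 * wsum l == x) (comps d i).

Lemma ncomps_sum d i x : ncomps d.+1 i x =
  (\sum_(c < i.+1) ncomps d (i - c) (x - 2 * (d%:Z + 1) * (c : nat)%:Z))%N.
Proof.
rewrite -(big_mkord xpredT (fun c => ncomps d (i - c) (x - 2 * (d%:Z + 1) * c%:Z))).
rewrite /ncomps compsS count_flatten sumnE -map_comp big_map /index_iota subn0.
apply: eq_bigr => c _; rewrite /= count_map; apply: eq_in_count => l.
rewrite mem_comps => /andP[/eqP sl _] /=; rewrite wsum_rcons sl.
by apply/eqP/eqP; lia.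
Qed.

(** Vectors whose last exponent is 0 are counted by the Gaussian polynomial for the smaller d; the
    others arise from degree one less by raising the last exponent. This is the recursion
    [gauss_recd]. *)
Lemma ncomps_gauss d i x : (ncomps d i x)%:Z = gauss d i.+1 x.
Proof.
elim: d i x => [|d IHd] i x.
  rewrite gauss0 /ncomps /= addn0 /wsum big_ord1 mul0r mulr0 eq_sym.
  by case: eqP.
have rec i' y : (ncomps d.+1 i' y)%:Z =
    gauss d i'.+1 y +
    \sum_(c < i') (ncomps d (i' - c.+1) (y - 2 * (d%:Z + 1) * (c : nat).+1%:Z))%:Z.
  rewrite ncomps_sum big_ord_recl /= mulr0 subr0 subn0 PoszD IHd; congr (_ + _).
  by rewrite Posz_sum.
elim: i x => [|i IHi] x; first by rewrite rec big_ord0 addr0 !gauss1.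
rewrite rec gauss_recd -IHi ncomps_sum; congr (_ + _).
rewrite Posz_sum; apply: eq_bigr => c _; rewrite subSS.
by congr (Posz (ncomps _ _ _)); lia.
Qed.

Definition gdeg n (g : 'I_n -> int) (m : 'X_{1..n}) : int :=
  \sum_(k < n) g k * (m k)%:Z.

(* Weights of the coordinates (a_0, ..., a_d, u_1, u_2) for the torus of SL(2). *)
Definition wt (d : nat) (k : 'I_d.+3) : int :=
  if (k < d.+1)%N then d%:Z - 2 * (k : nat)%:Z
  else if k == d.+1 :> nat then -1 else 1.

Definition mnm_pair d (j : nat) (l : seq nat) (c : nat) : 'X_{1..d.+3} :=
  [multinom nth 0%N (l ++ [:: c; j - c]%N) k | k < d.+3].

Definition wmons (d i j : nat) (w : int) : seq 'X_{1..d.+3} :=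
  [seq m <- [seq mnm_pair d j l c | l <- comps d i, c <- iota 0 j.+1] |
     gdeg (@wt d) m == w].

Lemma mnm_pairE d j l c (k : 'I_d.+3) : size l = d.+1 -> mnm_pair d j l c k =
  if (k < d.+1)%N then nth 0%N l k else if k == d.+1 :> nat then c else (j - c)%N.
Proof.
move=> hl; rewrite mnmE nth_cat hl; case: ltnP => // hk.
have := ltn_ord k; case: eqP => [->|ne hk']; first by rewrite subnn.
by have -> : (k - d.+1 = 1)%N by lia.
Qed.

Lemma big_ord3 (T : Type) (idx : T) (op : Monoid.law idx) d (f : 'I_d.+3 -> T) :
  \big[op/idx]_(k < d.+3) f k =
  op (op (\big[op/idx]_(k < d.+1) f (inord k)) (f (inord d.+1))) (f (inord d.+2)).
Proof.
rewrite big_ord_recr big_ord_recr /=; congr (op (op _ (f _)) (f _)).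
- by apply: eq_bigr => k _; congr f; apply: val_inj; rewrite /= inordK //; have := ltn_ord k; lia.
- by apply: val_inj; rewrite /= inordK.
- by apply: val_inj; rewrite /= inordK.
Qed.

Lemma val_inord3 d (k : 'I_d.+1) : (inord k : 'I_d.+3) = k :> nat.
Proof. by rewrite inordK //; have := ltn_ord k; lia. Qed.

Lemma bideg1E d (m : 'X_{1..d.+3}) :
  (\sum_(k < d.+3 | (k < d.+1)%N) m k = \sum_(k < d.+1) m (inord k))%N.
Proof.
rewrite big_mkcond big_ord3 /= !inordK // ltnn ltnNge leqnSn !addn0.
by apply: eq_bigr => k _; rewrite val_inord3 ltn_ord.
Qed.

Lemma bideg2E d (m : 'X_{1..d.+3}) :
  (\sum_(k < d.+3 | (d.+1 <= k)%N) m k = m (inord d.+1) + m (inord d.+2))%N.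
Proof.
rewrite big_mkcond big_ord3 /= !inordK // leqnn leqnSn big1 // => k _.
by rewrite val_inord3 leqNgt ltn_ord.
Qed.

Lemma sumn_nth_ord l n : size l = n -> sumn l = (\sum_(k < n) nth 0 l k)%N.
Proof. by move=> <-; rewrite sumnE (big_nth 0%N) big_mkord. Qed.

Lemma mem_wmons d i j w (m : 'X_{1..d.+3}) : m \in wmons d i j w <->
  [/\ (\sum_(k < d.+3 | (k < d.+1)%N) m k = i)%N,
      (\sum_(k < d.+3 | (d.+1 <= k)%N) m k = j)%N & gdeg (@wt d) m = w].
Proof.
rewrite mem_filter bideg1E bideg2E; split.
  case/andP => /eqP hw /allpairsP[[l c] /= [hl hc e]]; split=> //.
    move: hl; rewrite mem_comps => /andP[/eqP hs /eqP <-].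
    rewrite (sumn_nth_ord hs) e; apply: eq_bigr => k _.
    by rewrite mnm_pairE // val_inord3 ltn_ord.
  move: hl; rewrite mem_comps => /andP[/eqP hs _].
  have {}hc : c \in iota 0 j.+1 by []; rewrite mem_iota in hc.
  by rewrite e !mnm_pairE // !inordK // ltnn ltnNge leqnSn eqxx /= gtn_eqF //; lia.
case=> hi hj ->; rewrite eqxx andTb; apply/allpairsP.
exists (mkseq (fun k => m (inord k)) d.+1, m (inord d.+1)); split.
- rewrite mem_comps size_mkseq eqxx (sumn_nth_ord (size_mkseq _ _)) -hi.
  by apply/eqP; apply: eq_bigr => k _; rewrite nth_mkseq.
- by rewrite mem_iota /= add0n ltnS -hj leq_addr.
apply/mnmP => k; rewrite /= mnm_pairE ?size_mkseq //; case: ltnP => hk.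
  by rewrite nth_mkseq // inord_val.
case: eqP => [e|ne].
  by congr (m _); apply: val_inj; rewrite /= inordK // e.
have ek : k = d.+2 :> nat by have := ltn_ord k; lia.
by rewrite -hj addKn; congr (m _); apply: val_inj; rewrite /= inordK // ek.
Qed.

Lemma uniq_wmons d i j w : uniq (wmons d i j w).
Proof.
apply: filter_uniq; apply: allpairs_uniq; rewrite ?uniq_comps ?iota_uniq //.
move=> _ _ /allpairsP[[l1 c1] [h1 _ ->]] /allpairsP[[l2 c2] [h2 _ ->]] /mnmP /= e.
move: h1 h2 => /=; rewrite !mem_comps => /andP[/eqP h1 _] /andP[/eqP h2 _].
have -> : c1 = c2.
  by have := e (inord d.+1); rewrite !mnm_pairE // !inordK // ltnn eqxx.
suff -> : l1 = l2 by [].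
apply: (@eq_from_nth _ 0%N); rewrite ?h1 ?h2 // => k hk.
by have := e (inord k); rewrite !mnm_pairE // !inordK ?hk //; lia.
Qed.

(** The coordinates a_k contribute the sum of (d - 2k) l_k, which is id - 2 [wsum l]; u_1 and u_2
    contribute -c + (j - c). *)
Lemma gdeg_mnm_pair d i j l c : l \in comps d i -> (c <= j)%N ->
  gdeg (@wt d) (mnm_pair d j l c) =
  i%:Z * d%:Z + j%:Z - 2 * c%:Z - 2 * wsum l.
Proof.
rewrite mem_comps => /andP[/eqP hs /eqP hi] hc.
rewrite /gdeg big_ord3 /= !mnm_pairE // /wt !inordK // ltnn eqxx ltnNge leqnSn /=.
rewrite gtn_eqF // (eq_bigr (fun k : 'I_d.+1 =>
   d%:Z * (nth 0%N l k)%:Z - 2 * ((k : nat)%:Z * (nth 0%N l k)%:Z))); last first.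
  by move=> k _; rewrite mnm_pairE // !val_inord3 ltn_ord; lia.
rewrite sumrB -!mulr_sumr -hi (sumn_nth_ord hs) /wsum hs.
rewrite Posz_sum.
move: (\sum_(k < d.+1) (nth 0%N l k)%:Z) (\sum_(k < d.+1) (k : nat)%:Z * _) => A B.
by lia.
Qed.

Lemma size_wmons d i j w : (size (wmons d i j w))%:Z =
  \sum_(c < j.+1) gauss d i.+1 (i%:Z * d%:Z + j%:Z - w - 2 * (c : nat)%:Z).
Proof.
rewrite /wmons size_filter.
(* Generalised to sublists to allow induction on [L]; once c is fixed, the weight prescribes
   [wsum l]. *)
have hc (s : seq nat) (L : seq (seq nat)) : {subset s <= iota 0 j.+1} -> {subset L <= comps d i} ->
  count (fun m => gdeg (@wt d) m == w) [seq mnm_pair d j l c | l <- L, c <- s] =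
  (\sum_(c <- s) count (fun l => 2 * wsum l == i%:Z * d%:Z + j%:Z - w - 2 * c%:Z)%R L)%N.
  move=> hs; elim: L => [|l L IHL] hL /=; first by rewrite big1.
  rewrite count_cat IHL => [|l' hl']; last by apply: hL; rewrite inE hl' orbT.
  rewrite big_split /=; congr (_ + _)%N.
  rewrite count_map -sumn_count sumnE big_map big_seq [RHS]big_seq.
  apply: eq_bigr => c hcs /=; congr (nat_of_bool _).
  have := hs _ hcs; rewrite mem_iota add0n ltnS => hcj.
  rewrite (gdeg_mnm_pair (hL _ (mem_head _ _)) hcj); apply/eqP/eqP; lia.
rewrite hc // -(big_mkord xpredT (fun c => gauss d i.+1 (i%:Z * d%:Z + j%:Z - w - 2 * c%:Z))).
rewrite Posz_sum /index_iota subn0; apply: eq_bigr => c _.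
by rewrite -ncomps_gauss.
Qed.

Lemma rhs_wmons d i j : (0 < d)%N ->
  rhs d i j = (size (wmons d i j 0))%:Z - (size (wmons d i j 2))%:Z.
Proof.
move=> d0; rewrite rhsE // !size_wmons.
pose f (c : nat) := gauss d i.+1 (i%:Z * d%:Z + j%:Z - 2 * c%:Z).
have step (c : 'I_j.+1) : gauss d i.+1 (i%:Z * d%:Z + j%:Z - 0 - 2 * (c : nat)%:Z) -
    gauss d i.+1 (i%:Z * d%:Z + j%:Z - 2 - 2 * (c : nat)%:Z) = - (f c.+1 - f c).
  by rewrite opprB /f; congr (gauss _ _ _ - gauss _ _ _); lia.
rewrite -[RHS]sumrB (eq_bigr _ (fun c _ => step c)).
rewrite -(big_mkord xpredT (fun c => - (f c.+1 - f c))) sumrN telescope_sumr // opprB.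
(* The telescoped sum is f 0 - f (j+1); symmetry moves the exponent id + j of f 0 to id - j. *)
by rewrite /f -[gauss _ _ (_ - 2 * 0)]gauss_sym; congr (gauss _ _ _ - gauss _ _ _); lia.
Qed.

(** * Weight arguments for sl(2) *)

Section Sl2.
Variables (K : numFieldType) (V : lmodType K) (E F H : {linear V -> V}).
Hypotheses (EF : forall v, E (F v) - F (E v) = H v)
  (HE : forall v, H (E v) - E (H v) = 2%:R *: E v)
  (HF : forall v, H (F v) - F (H v) = - 2%:R *: F v).

Lemma sl2_weight_iterE (w : K) v n : H v = w *: v ->
  H (iter n E v) = (w + (2 * n)%:R) *: iter n E v.
Proof.
move=> Hv; elim: n => [|n IHn] /=; first by rewrite addr0.
by rewrite -[H _](subrK (E (H (iter n E v)))) HE IHn linearZ -scalerDl;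
   congr (_ *: _); rewrite mulnS natrD; ring.
Qed.

Lemma sl2_weight_iterF (w : K) v n : H v = w *: v ->
  H (iter n F v) = (w - (2 * n)%:R) *: iter n F v.
Proof.
move=> Hv; elim: n => [|n IHn] /=; first by rewrite subr0.
by rewrite -[H _](subrK (F (H (iter n F v)))) HF IHn linearZ -scalerDl;
   congr (_ *: _); rewrite mulnS natrD; ring.
Qed.

(** F E^(n+1) v is a nonzero multiple of E^n v, so the vanishing of E^N v descends step by step to v
    itself. *)
Lemma sl2_ker_EF v N : H v = 2%:R *: v -> E (F v) = 0 -> iter N E v = 0 -> v = 0.
Proof.
move=> Hv EFv; have rec n :
    F (iter n.+1 E v) = - (n.+1 * n.+2)%:R *: iter n E v.
  elim: n => [|n IHn]; first by rewrite /= -[F _]opprK -[- F _]add0r -EFv EF Hv -scaleNr.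
  have := EF (iter n.+1 E v); rewrite IHn (sl2_weight_iterE _ Hv) linearZ => e.
  have -> : F (iter n.+2 E v) = - (n.+1 * n.+2)%:R *: iter n.+1 E v -
      (2%:R + (2 * n.+1)%:R) *: iter n.+1 E v by rewrite -e opprB addrC subrK.
  rewrite -scalerBl; congr (_ *: _); rewrite !natrM -!natr1; ring.
elim: N => [|N IHN] // EN; apply: IHN; have := rec N; rewrite EN linear0 => /esym/eqP.
by rewrite scaler_eq0 oppr_eq0 pnatr_eq0 /= => /eqP.
Qed.

(** Here E F^(n+1) v = -n(n+1) F^n v. The factor vanishes only at n = 0, so the descent from F^N v =
    0 stops at F v. *)
Lemma sl2_weight0_ker v N : H v = 0 -> E v = 0 -> iter N F v = 0 -> F v = 0.
Proof.
move=> Hv0 Ev; have Hv : H v = (0 : K) *: v by rewrite scale0r.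
have rec n : E (iter n.+1 F v) = - (n * n.+1)%:R *: iter n F v.
  elim: n => [|n IHn]; first by rewrite mul0n oppr0 scale0r -Hv0 -EF Ev linear0 subr0.
  have := EF (iter n.+1 F v); rewrite IHn (sl2_weight_iterF _ Hv) linearZ => /eqP.
  rewrite subr_eq => /eqP /= ->; rewrite -scalerDl; congr (_ *: _).
  rewrite !natrM -!natr1; ring.
case: N => [/= ->|]; first by rewrite linear0.
elim=> [|N IHN] // FN; apply: IHN; have := rec N.+1; rewrite FN linear0 => /esym/eqP.
by rewrite scaler_eq0 oppr_eq0 pnatr_eq0 /= => /eqP.
Qed.

End Sl2.

(** * Linear vector fields on a polynomial ring, and Euler operators *)

Section MonomialFields.
Variables (n : nat) (K : comNzRingType).
Implicit Types (a b : 'I_n -> K) (s t : 'I_n -> 'I_n) (P : {mpoly K[n]}).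

(** The derivation sending X_k to a_k X_(s k). The operators E, F and H all have this shape, each
    coordinate going to a multiple of a single coordinate. *)
Definition vfield a s P : {mpoly K[n]} := \sum_k a k *: ('X_(s k) * P^`M(k)).

Lemma vfield_is_linear a s : linear (vfield a s).
Proof.
move=> c P Q; rewrite /vfield scaler_sumr -big_split; apply: eq_bigr => k _ /=.
by rewrite mderivD mderivZ mulrDr -scalerAr scalerDr !scalerA mulrC.
Qed.

HB.instance Definition _ a s := GRing.isLinear.Build K {mpoly K[n]} {mpoly K[n]}
  _ (vfield a s) (vfield_is_linear a s).

Lemma mderiv_var (i k : 'I_n) : ('X_i : {mpoly K[n]})^`M(k) = (i == k)%:R.
Proof.
rewrite mderivX mnm1E; case: eqP => [->|_]; last by rewrite scale0r.
by rewrite scale1r (_ : (_ - _)%MM = 0%MM) ?mpolyX0 //; apply/mnmP => l; rewrite mnmBE subnn mnm0E.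
Qed.

Lemma vfield_vfield a s b t P : vfield a s (vfield b t P) =
  vfield (fun k => b k * a (t k)) (s \o t) P +
  \sum_l \sum_k (a l * b k) *: ('X_(s l) * 'X_(t k) * P^`M(k)^`M(l)).
Proof.
rewrite /vfield; under eq_bigr => l _.
  rewrite [_^`M(l)]raddf_sum /= mulr_sumr scaler_sumr.
  under eq_bigr => k _ do
    rewrite mderivZ mderivM mderiv_var -scalerAr mulrDr scalerA scalerDr !mulrA.
  rewrite big_split /=; over.
rewrite big_split /=; congr (_ + _).
rewrite exchange_big /=; apply: eq_bigr => k _; rewrite (bigD1 (t k)) //= eqxx mulr1.
rewrite big1 ?addr0 1?mulrC // => l /negbTE; rewrite eq_sym => ->.
by rewrite mulr0 mul0r scaler0.
Qed.

(** The second-order parts of the two compositions agree because partial derivatives commute; only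
    first-order terms survive. *)
Lemma vfield_comm a s b t P : vfield a s (vfield b t P) - vfield b t (vfield a s P) =
  vfield (fun k => b k * a (t k)) (s \o t) P - vfield (fun k => a k * b (s k)) (t \o s) P.
Proof.
rewrite !vfield_vfield opprD addrACA [X in _ + X](_ : _ = 0) ?addr0 //.
apply/eqP; rewrite subr_eq0 exchange_big /=; apply/eqP; apply: eq_bigr => l _.
apply: eq_bigr => k _; rewrite mderiv_comm (mulrC (a k)).
by rewrite ['X_(s _) * _]mulrC.
Qed.

Definition euler (g : 'I_n -> int) P := vfield (fun k => (g k)%:~R) id P.

HB.instance Definition _ g := GRing.Linear.copy (euler g) (vfield (fun k => (g k)%:~R) id).

Lemma mcoeff_mul_var_deriv k m P : ('X_k * P^`M(k))@_m = (m k)%:R * P@_m.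
Proof.
elim/mpolyind: P => [|c m' P _ _ IHP]; first by rewrite mderiv0 mulr0 !mcoeff0 mulr0.
rewrite mderivD mulrDr !mcoeffD IHP mulrDr; congr (_ + _).
rewrite mderivZ mderivX scalerA -scalerAr -mpolyXD !mcoeffZ !mcoeffX.
case: (eqVneq (m' k) 0%N) => [e0|ne0].
  rewrite e0 mulr0 mul0r; case: eqP => [<-|]; first by rewrite e0 mul0r.
  by rewrite !mulr0.
rewrite addmC submK; last by rewrite lep1mP.
by case: eqP => [->|]; rewrite ?mulr0 // !mulr1 mulrC.
Qed.

Lemma mcoeff_euler g m P : (euler g P)@_m = (gdeg g m)%:~R * P@_m.
Proof.
rewrite /euler /vfield raddf_sum /gdeg rmorph_sum mulr_suml; apply: eq_bigr => k _ /=.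
by rewrite mcoeffZ mcoeff_mul_var_deriv mulrA rmorphM.
Qed.

Lemma euler_vfield_comm g a s (c : int) P : (forall k, a k != 0 -> g (s k) = g k + c) ->
  euler g (vfield a s P) - vfield a s (euler g P) = c%:~R *: vfield a s P.
Proof.
move=> h; rewrite vfield_comm /vfield -sumrB scaler_sumr; apply: eq_bigr => k _ /=.
rewrite -scalerBl scalerA; congr (_ *: _); have [->|/h->] := eqVneq (a k) 0.
  by rewrite mul0r !mulr0 subrr.
by rewrite rmorphD /= mulrC -mulrBl addrC addrA addNr add0r.
Qed.
End MonomialFields.

(** Monomials are eigenvectors of [euler g] with eigenvalue [gdeg g m], and distinct integers stay
    distinct in characteristic zero. *)
Lemma euler_eigen n (K : numFieldType) g (w : int) (P : {mpoly K[n]}) :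
  euler g P = w%:~R *: P <-> (forall m, m \in msupp P -> gdeg g m = w).
Proof.
split=> [/mpolyP h m|h].
  rewrite mcoeff_msupp => nz; have := h m; rewrite mcoeff_euler mcoeffZ.
  by move/(mulIf nz)/(intr_inj).
apply/mpolyP => m; rewrite mcoeff_euler mcoeffZ.
have [/h->//|] := boolP (m \in msupp P).
by move/memN_msupp_eq0->; rewrite !mulr0.
Qed.

(** * The derivations E and F *)

(* The infinitesimal generators of the two root subgroups of SL(2): [b = false] for
   the upper one (x -> x - s y on forms), [b = true] for the lower one
   (y -> y - s x). [rexp] is the exponent in a_k of the variable being moved. *)
Definition rexp (d : nat) (b : bool) (k : nat) : nat := if b then k else (d - k)%N.

Definition rcoef (K : numFieldType) (d : nat) (b : bool) (k : 'I_d.+3) : K :=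
  if (k < d.+1)%N then (if (rexp d b k < d)%N then - (rexp d b k).+1%:R else 0)
  else (k == d.+1 + b :> nat)%N%:R.

(** Where a coordinate has no successor, [rcoef] is zero and the value here is a mere default; hence
    the hypothesis that [rcoef] is nonzero in [val_rnext] and [rnextK]. *)
Definition rnext (d : nat) (b : bool) (k : 'I_d.+3) : 'I_d.+3 :=
  inord (if (k < d.+1)%N then (if b then k.+1 else k.-1) else (d.+2 - b)%N).

Section RootFields.
Variables (K : numFieldType) (d : nat).
Implicit Types (P : {mpoly K[d.+3]}) (b : bool) (k : 'I_d.+3).

Notation fE := (vfield (@rcoef K d false) (@rnext d false)).
Notation fF := (vfield (@rcoef K d true) (@rnext d true)).
Notation fH := (euler (@wt d)).

Lemma rcoef_neq0 b k : rcoef K b k != 0 ->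
  ((rexp d b k < d) && (k < d.+1) || (k == d.+1 + b :> nat))%N.
Proof.
rewrite /rcoef; case: ifP => hk; first by case: ifP; rewrite ?eqxx.
by case: (k == _ :> nat)%N; rewrite ?orbT // eqxx.
Qed.

Lemma val_rnext b k : rcoef K b k != 0 -> rnext b k =
  (if (k < d.+1)%N then (if b then k.+1 else k.-1) else (d.+2 - b)%N) :> nat.
Proof.
move=> /rcoef_neq0 h; rewrite inordK //; move: h; have := ltn_ord k.
by rewrite /rexp; case: b; case: ifP => //=; lia.
Qed.

Lemma rnextK b k : rcoef K b k != 0 -> rnext (~~ b) (rnext b k) = k.
Proof.
move=> h; apply: val_inj; rewrite {1}/rnext /= (val_rnext h).
have := rcoef_neq0 h; have := ltn_ord k; rewrite /rexp.
by case: b {h} => /=; case: (ltnP k d.+1) => /= h1 h2 h3; rewrite inordK; case: ifP; lia.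
Qed.

Lemma rcoef_prod b k : rcoef K b k * rcoef K (~~ b) (rnext b k) =
  if (k < d.+1)%N then ((rexp d b k).+1 * (d - rexp d b k))%:R
  else (k == d.+1 + b :> nat)%N%:R.
Proof.
have [e|h] := eqVneq (rcoef K b k) 0.
  rewrite e mul0r; move: e; rewrite /rcoef.
  case: ifP => hk; last by move=> ->.
  case: ifP => hr; first by move/eqP; rewrite oppr_eq0 pnatr_eq0.
  by move=> _; rewrite (_ : d - _ = 0)%N ?muln0 //; lia.
rewrite /rcoef (val_rnext h); have := rcoef_neq0 h; have := ltn_ord k.
case: (ltnP k d.+1) => hk h2 /= h3.
  have h4 : (rexp d b k < d)%N by move: h3; rewrite /rexp; case: (b); lia.
  rewrite h4 (_ : ((if b then k.+1 else k.-1) < d.+1)%N); last first.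
    by move: h4; rewrite /rexp; case: (b); lia.
  rewrite ifT; last by move: h4; rewrite /rexp; case: (b) => /=; lia.
  rewrite mulrNN -natrM; congr (_ * _)%:R; move: h4; rewrite /rexp; case: (b) => /=; lia.
rewrite andbF /= in h3; rewrite h3 ifF; last by case: (b); lia.
by rewrite (_ : (_ == _)%N) ?mulr1 //; case: (b); lia.
Qed.

(** On a_k the round trips differ by (k+1)(d-k) - k(d-k+1) = d - 2k, and on u_1 and u_2 by -1 and 1:
    these are the weights. *)
Lemma fE_fF P : fE (fF P) - fF (fE P) = fH P.
Proof.
rewrite vfield_comm /euler /vfield -sumrB; apply: eq_bigr => k _ /=.
have hX b : (rcoef K b k * rcoef K (~~ b) (rnext b k)) *:
    ('X_(rnext (~~ b) (rnext b k)) * P^`M(k)) =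
    (rcoef K b k * rcoef K (~~ b) (rnext b k)) *: ('X_k * P^`M(k)).
  by have [->|/rnextK->//] := eqVneq (rcoef K b k) 0; rewrite mul0r !scale0r.
rewrite (hX true) (hX false) -scalerBl; congr (_ *: _).
rewrite !rcoef_prod /wt /rexp; case: ltnP => hk.
  have ek : (d - (d - k) = k)%N by rewrite subKn // -ltnS.
  have natint n : n%:R = n%:Z%:~R :> K by rewrite pmulrn.
  by rewrite ek !natint -intrB; congr (_%:~R); nia.
have := ltn_ord k; case: eqP => [->|ne] hk2.
  by rewrite addn1 addn0 gtn_eqF // subr0.
have -> : k = d.+1 :> nat by lia.
by rewrite addn0 eqxx sub0r.
Qed.

Lemma fH_vfield b P : fH (vfield (@rcoef K d b) (@rnext d b) P) -
  vfield (@rcoef K d b) (@rnext d b) (fH P) =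
  ((if b then -2 else 2) : int)%:~R *: vfield (@rcoef K d b) (@rnext d b) P.
Proof.
apply: euler_vfield_comm => k h; rewrite /wt (val_rnext h).
have := rcoef_neq0 h; have := ltn_ord k; rewrite /rexp.
by case: b {h} => /=; case: (ltnP k d.+1) => /= h1 h2 h3; do ?case: ifP; lia.
Qed.

Definition wspace (i j : nat) (w : int) P := {subset msupp P <= wmons d i j w}.

Let g1 k : int := (k < d.+1)%N%:Z.
Let g2 k : int := (d.+1 <= k)%N%:Z.

Lemma gdeg_nat (p : pred 'I_d.+3) (m : 'X_{1..d.+3}) :
  gdeg (fun k => (p k)%:Z) m = (\sum_(k | p k) m k)%N.
Proof.
rewrite Posz_sum /gdeg [RHS]big_mkcond; apply: eq_bigr => k _.
by case: (p k); rewrite ?mul1r ?mul0r.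
Qed.

(** Bidegree and weight become eigenvalues of three Euler operators, so the effect of E and F on
    them reduces to commutators. *)
Lemma wspaceP i j w P : wspace i j w P <->
  [/\ euler g1 P = i%:Z%:~R *: P, euler g2 P = j%:Z%:~R *: P & fH P = w%:~R *: P].
Proof.
split=> [h|[/euler_eigen h1 /euler_eigen h2 /euler_eigen h3] m hm].
  split; apply/euler_eigen => m /h /mem_wmons[e1 e2 e3] //; first by rewrite gdeg_nat e1.
  by rewrite gdeg_nat e2.
apply/mem_wmons; split; last exact: h3; have := h1 m hm; have := h2 m hm.
  by rewrite !gdeg_nat => _ [].
by rewrite !gdeg_nat => [[]].
Qed.

Lemma wspace_vfield b i j w P : wspace i j w P ->
  wspace i j (w + (if b then -2 else 2)) (vfield (@rcoef K d b) (@rnext d b) P).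
Proof.
move=> /wspaceP[h1 h2 h3]; apply/wspaceP.
have hc g c u : (forall k, rcoef K b k != 0 -> g (rnext b k) = g k + c) ->
    euler g P = u%:~R *: P ->
    euler g (vfield (@rcoef K d b) (@rnext d b) P) =
    (u + c)%:~R *: vfield (@rcoef K d b) (@rnext d b) P.
  move=> hg eg; have /eqP := euler_vfield_comm P hg; rewrite subr_eq eg linearZ => /eqP ->.
  by rewrite -scalerDl -intrD addrC.
split.
- rewrite -[i%:Z]addr0; apply: hc h1 => k h; rewrite addr0 /g1 (val_rnext h).
  have := rcoef_neq0 h; have := ltn_ord k; rewrite /rexp.
  by case: b {h} => /=; case: (ltnP k d.+1) => /= a1 a2 a3; lia.
- rewrite -[j%:Z]addr0; apply: hc h2 => k h; rewrite addr0 /g2 (val_rnext h).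
  have := rcoef_neq0 h; have := ltn_ord k; rewrite /rexp.
  by case: b {h} => /=; case: (ltnP k d.+1) => /= a1 a2 a3; lia.
apply: hc h3 => k h; rewrite /wt (val_rnext h).
have := rcoef_neq0 h; have := ltn_ord k; rewrite /rexp.
by case: b {h} => /=; case: (ltnP k d.+1) => /= a1 a2 a3; do ?case: ifP; lia.
Qed.

Lemma wspace_iter b i j w P n : wspace i j w P ->
  wspace i j (w + (if b then -2 else 2) * n%:Z)
    (iter n (vfield (@rcoef K d b) (@rnext d b)) P).
Proof.
move=> hP; elim: n => [|n IHn]; first by rewrite mulr0 addr0.
have -> : w + (if b then -2 else 2) * n.+1%:Z =
  w + (if b then -2 else 2) * n%:Z + (if b then -2 else 2) by case: (b); lia.
exact: wspace_vfield.
Qed.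

Lemma wmons_bound i j w m : m \in wmons d i j w -> `|w| <= (d.+1 * (i + j))%:Z.
Proof.
move=> /mem_wmons[h1 h2 <-]; rewrite /gdeg.
apply: le_trans (ler_norm_sum _ _ _) _.
have -> : (d.+1 * (i + j))%:Z = \sum_(k < d.+3) d.+1%:Z * (m k)%:Z.
  rewrite -mulr_sumr -Posz_sum -h1 -h2 PoszM; congr (_ * Posz _).
  rewrite [RHS](bigID (fun k : 'I_d.+3 => k < d.+1)%N) /=; congr (_ + _)%N.
  by apply: eq_bigl => k; rewrite leqNgt.
apply: ler_sum => k _; rewrite normrM ler_wpM2r //= /wt.
rewrite ler_norml; have := ltn_ord k.
by case: (ltnP k d.+1) => h h'; [|case: eqP => _]; apply/andP; split; lia.
Qed.

Lemma wspace_nilp b i j w P : wspace i j w P ->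
  exists n, iter n (vfield (@rcoef K d b) (@rnext d b)) P = 0.
Proof.
(* Each application moves the weight by 2 in a fixed direction; after this many it exceeds the bound
   of [wmons_bound] and no monomial is left. *)
move=> hP; exists (`|w| + d.+1 * (i + j)).+1%N.
apply: msuppnil0; have := @wspace_iter b i j w P (`|w| + d.+1 * (i + j)).+1 hP.
rewrite /wspace; case: (msupp _) => // m s /(_ m (mem_head _ _)) /wmons_bound.
by case: b {hP}; lia.
Qed.

(** A highest weight vector of weight 0 on which F is nilpotent spans a trivial representation. *)
Lemma wspace0_invariant i j P : wspace i j 0 P -> fE P = 0 -> fF P = 0.
Proof.
move=> hP EP; have [n hn] := @wspace_nilp true _ _ _ _ hP.
have HP : fH P = 0 by have /wspaceP[_ _ ->] := hP; rewrite scale0r.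
have HF v : fH (fF v) - fF (fH v) = - 2%:R *: fF v by rewrite (fH_vfield true).
exact: (sl2_weight0_ker fE_fF HF HP EP hn).
Qed.

Lemma fE_fF_inj i j P : wspace i j 2 P -> fE (fF P) = 0 -> P = 0.
Proof.
move=> hP EP; have [n hn] := @wspace_nilp false _ _ _ _ hP.
have HP : fH P = 2%:R *: P by have /wspaceP[] := hP.
have HE v : fH (fE v) - fE (fH v) = 2%:R *: fE v by rewrite (fH_vfield false).
exact: (sl2_ker_EF fE_fF HE HP EP hn).
Qed.

End RootFields.

(** * Dimension of the kernel *)

Section MonomialCoordinates.
Variables (n : nat) (K : fieldType).
Implicit Types (s t : seq 'X_{1..n}) (P : {mpoly K[n]}).

Definition of_coords s (v : 'rV[K]_(size s)) : {mpoly K[n]} :=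
  \sum_a v 0 a *: 'X_[nth 0%MM s a].

Definition coords s P : 'rV[K]_(size s) := \row_a P@_(nth 0%MM s a).

Lemma of_coords_is_linear s : linear (@of_coords s).
Proof.
move=> c u v; rewrite /of_coords scaler_sumr -big_split; apply: eq_bigr => a _ /=.
by rewrite !mxE scalerDl scalerA.
Qed.

HB.instance Definition _ s := GRing.isLinear.Build K 'rV[K]_(size s) {mpoly K[n]}
  _ (@of_coords s) (of_coords_is_linear (s := s)).

Lemma coords_is_linear s : linear (coords s).
Proof. by move=> c P Q; apply/rowP => a; rewrite !mxE mcoeffD mcoeffZ. Qed.

HB.instance Definition _ s := GRing.isLinear.Build K {mpoly K[n]} 'rV[K]_(size s)
  _ (coords s) (coords_is_linear s).

Lemma of_coordsK s v : uniq s -> coords s (of_coords v) = v.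
Proof.
move=> us; apply/rowP => a; rewrite mxE raddf_sum (bigD1 a) //= mcoeffZ mcoeffX eqxx mulr1.
rewrite big1 ?addr0 // => b /negbTE nba; rewrite mcoeffZ mcoeffX nth_uniq //.
by rewrite (inj_eq val_inj) nba mulr0.
Qed.

Lemma coordsK s P : uniq s -> {subset msupp P <= s} -> of_coords (coords s P) = P.
Proof.
move=> us hP; apply/mpolyP => m; rewrite raddf_sum /=.
under eq_bigr => a _ do rewrite mxE mcoeffZ mcoeffX.
have [hm|hm] := boolP (m \in s); last first.
  rewrite big1 ?(memN_msupp_eq0 (contra (hP m) hm)) // => a _.
  by case: eqP hm => [<-|_]; rewrite ?mem_nth // mulr0.
have im : (index m s < size s)%N by rewrite index_mem.
rewrite (bigD1 (Ordinal im)) //= nth_index // eqxx mulr1 big1 ?addr0 // => a /negP nba.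
case: eqP => [e|_]; last by rewrite mulr0.
by case: nba; apply/eqP/val_inj; rewrite /= -e index_uniq.
Qed.

Lemma msupp_of_coords s v : {subset msupp (@of_coords s v) <= s}.
Proof.
move=> m /msupp_sum_le /flattenP[_ /mapP[a _ ->]] /msuppZ_le.
by rewrite msuppX inE => /eqP->; rewrite mem_nth.
Qed.

Definition coords_mx s t (f : {linear {mpoly K[n]} -> {mpoly K[n]}}) :
  'M[K]_(size s, size t) := \matrix_a coords t (f 'X_[nth 0%MM s a]).

Lemma mul_coords_mx s t f v : v *m coords_mx s t f = coords t (f (of_coords v)).
Proof.
rewrite mulmx_sum_row /of_coords !linear_sum; apply: eq_bigr => a _.
by rewrite rowK !linearZ.
Qed.

End MonomialCoordinates.

(** E F is injective on the span of [t], so the matrix of E has full rank [size t], and rank-nullity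
    gives the dimension of the kernel. *)
Lemma has_basis_kernel n (s t : seq 'X_{1..n})
    (E F : {linear {mpoly C[n]} -> {mpoly C[n]}}) :
  uniq s -> uniq t ->
  (forall P, {subset msupp P <= s} -> {subset msupp (E P) <= t}) ->
  (forall P, {subset msupp P <= t} -> {subset msupp (F P) <= s}) ->
  (forall P, {subset msupp P <= t} -> E (F P) = 0 -> P = 0) ->
  (size t <= size s)%N /\
  has_basis n (fun P => {subset msupp P <= s} /\ E P = 0) (size s - size t).
Proof.
move=> us ut hE hF hEF; pose A := coords_mx s t E; pose B := coords_mx t s F.
have kerA P : {subset msupp P <= s} -> (E P == 0) = (coords s P *m A == 0).
  move=> hP; rewrite mul_coords_mx coordsK //; apply/eqP/eqP => [->|e].
    by rewrite linear0.
  by rewrite -(coordsK ut (hE _ hP)) e linear0.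
have rA : \rank A = size t.
  apply/eqP; rewrite eqn_leq rank_leq_col /=.
  apply: leq_trans (mxrankM_maxr B A).
  suff /eqP-> : row_free (B *m A) by [].
  apply: inj_row_free => v; rewrite mulmxA (mul_coords_mx s F) => /eqP.
  have hv := hF _ (@msupp_of_coords _ _ t v).
  rewrite -kerA // => /eqP /(hEF _ (@msupp_of_coords _ _ t v)) e.
  by rewrite -(of_coordsK v ut) e linear0.
split; first by rewrite -rA rank_leq_row.
rewrite -rA -mxrank_ker; set R := row_base (kermx A).
exists (fun k => of_coords (row k R)); split.
- move=> k; have hs := @msupp_of_coords _ _ s (row k R); split=> //.
  apply/eqP; rewrite kerA // of_coordsK //; apply/eqP/sub_kermxP.
  by apply: submx_trans (row_sub _ _) _; rewrite eq_row_base.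
- move=> c hc k; pose v : 'rV[C]_(\rank (kermx A)) := \row_k c k.
  suff -> : c k = v 0 k.
    suff -> : v = 0 by rewrite mxE.
    apply/eqP; rewrite -(mulmx_free_eq0 _ (row_base_free (kermx A))) -/R; apply/eqP.
    have e0 : of_coords (v *m R) = 0.
      rewrite mulmx_sum_row [LHS]linear_sum; apply: etrans (hc); apply: eq_bigr => a _.
      by rewrite linearZ mxE.
    by rewrite -[LHS](of_coordsK _ us) e0 linear0.
  by rewrite mxE.
move=> P [hP /eqP]; rewrite kerA // => /eqP/sub_kermxP.
rewrite -(eq_row_base (kermx A)) => /submxP[D eD]; exists (D 0).
rewrite -{1}(coordsK us hP) eD mulmx_sum_row [LHS]linear_sum; apply: eq_bigr => a _.
by rewrite linearZ.
Qed.

(** * Polynomial functions along curves *)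

Lemma poly_eq_horner (K : numFieldType) (p q : {poly K}) :
  (forall x, p.[x] = q.[x]) -> p = q.
Proof.
move=> h; apply/eqP; rewrite -subr_eq0; apply/negPn/negP => nz.
(* In characteristic zero the natural numbers give as many distinct roots as needed. *)
pose s : seq K := [seq i%:R | i <- iota 0 (size (p - q))].
have us : uniq s.
  by rewrite map_inj_uniq ?iota_uniq // => x y /eqP; rewrite eqr_nat => /eqP.
have rs : all (root (p - q)) s.
  by apply/allP => x _; rewrite rootE hornerD hornerN h subrr.
by have := max_poly_roots nz rs us; rewrite size_map size_iota ltnn.
Qed.

Lemma deriv_eq0 (K : numFieldType) (p : {poly K}) x y : p^`() = 0 -> p.[x] = p.[y].
Proof.
move=> h; have -> : p = (p`_0)%:P.
  apply/polyP => [[|i]]; rewrite coefC //=.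
  have := coef_deriv p i; rewrite h coef0 => /esym/eqP.
  by rewrite mulrn_eq0 => /eqP.
by rewrite !hornerC.
Qed.

Lemma deriv_nderivn (K : nzRingType) (p : {poly K}) n :
  (p^`N(n))^`() = p^`N(n.+1) *+ n.+1.
Proof.
apply/polyP => i; rewrite coef_deriv coefMn !coef_nderivn addnS -!mulrnA; congr (_ *+ _).
have := mul_bin_left (n + i).+1 n; rewrite (_ : (n + i).+1 - n = i.+1)%N; last by lia.
by rewrite addSn mulnC [RHS]mulnC => ->.
Qed.

Lemma coef_comp_XsubC (K : numFieldType) (p : {poly K}) (s : K) k :
  (p \Po ('X - s%:P))`_k = (p^`N(k)).[- s].
Proof.
have -> : p \Po ('X - s%:P) = \poly_(i < size p) (p^`N(i)).[- s].
  apply: poly_eq_horner => y; rewrite horner_comp hornerXsubC horner_poly addrC.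
  by rewrite nderiv_taylor //; apply: mulrC.
by rewrite coef_poly; case: ltnP => // /nderivn_poly0->; rewrite horner0.
Qed.

Section Mmap.
Variables (n : nat) (K : comNzRingType).
Implicit Types (P : {mpoly K[n]}) (S T : comNzRingType).

Lemma rmorph_mmap S T (f : {rmorphism K -> S}) (h : 'I_n -> S)
    (g : {rmorphism S -> T}) P :
  g (mmap f h P) = mmap (g \o f) (g \o h) P.
Proof.
rewrite /mmap rmorph_sum; apply: eq_bigr => m _; rewrite rmorphM /mmap1 rmorph_prod.
by congr (_ * _); apply: eq_bigr => i _; rewrite rmorphXn.
Qed.

Lemma eq_mmap S (f f' : K -> S) (h h' : 'I_n -> S) P :
  f =1 f' -> h =1 h' -> mmap f h P = mmap f' h' P.
Proof.
move=> ef eh; rewrite /mmap; apply: eq_bigr => m _; rewrite ef.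
by congr (_ * _); apply: mmap1_eq.
Qed.

Lemma horner_mmap (c : 'I_n -> {poly K}) P x :
  (mmap polyC c P).[x] = P.@[fun i => (c i).[x]].
Proof.
rewrite -/(horner_eval x _) rmorph_mmap; apply: eq_mmap => // a.
by rewrite /= /horner_eval hornerC.
Qed.

(** The chain rule. By the Leibniz rule it passes to products ([hM]), which reduces it to the
    variables. *)
Lemma deriv_mmap (c : 'I_n -> {poly K}) P :
  (mmap polyC c P)^`() = \sum_k mmap polyC c (P^`M(k)) * (c k)^`().
Proof.
have hM Q R : (mmap polyC c Q)^`() = \sum_k mmap polyC c (Q^`M(k)) * (c k)^`() ->
    (mmap polyC c R)^`() = \sum_k mmap polyC c (R^`M(k)) * (c k)^`() ->
    (mmap polyC c (Q * R))^`() = \sum_k mmap polyC c ((Q * R)^`M(k)) * (c k)^`().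
  move=> hQ hR; rewrite rmorphM derivM hQ hR mulr_suml mulr_sumr -big_split.
  apply: eq_bigr => k _ /=; rewrite mderivM rmorphD !rmorphM mulrDl /=.
  by rewrite mulrAC mulrA.
have h1 : (mmap polyC c 1)^`() = \sum_k mmap polyC c (1^`M(k)) * (c k)^`().
  rewrite rmorph1 derivC big1 // => k _.
  by rewrite -mpolyC1 mderivC rmorph0 mul0r.
elim/mpolyind: P => [|a m P _ _ IHP].
  by rewrite rmorph0 deriv0 big1 // => k _; rewrite mderiv0 rmorph0 mul0r.
rewrite rmorphD derivD IHP.
under [RHS]eq_bigr => k _ do rewrite mderivD rmorphD mulrDl.
rewrite big_split /=; congr (_ + _).
under [RHS]eq_bigr => k _ do rewrite mderivZ mmapZ -mulrA.
rewrite mmapZ -mulr_sumr mul_polyC derivZ -mul_polyC; congr (_ * _).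
rewrite mpolyXE_id; elim/big_ind: _ => // i _.
elim: (m i) => [|e IHe]; first by rewrite expr0.
rewrite exprS; apply: hM => //; rewrite mmapX mmap1U (bigD1 i) //= mderiv_var eqxx.
rewrite rmorph1 mul1r big1 ?addr0 // => k /negbTE nki.
by rewrite mderiv_var eq_sym nki rmorph0 mul0r.
Qed.

End Mmap.

(** If P vanishes everywhere then so do its partial derivatives; differentiating lowers m, and the
    claim on its coefficient follows by induction on [mdeg m]. *)
Lemma mpoly_eq0_meval n (K : numFieldType) (P : {mpoly K[n]}) :
  (forall x, P.@[x] = 0) -> P = 0.
Proof.
have hd (Q : {mpoly K[n]}) k : (forall x, Q.@[x] = 0) -> forall x, Q^`M(k).@[x] = 0.
  (* The line through x in direction k: along it the chain rule leaves only the k-th partial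
     derivative. *)
  move=> hQ x; pose c i : {poly K} := (x i)%:P + (i == k)%:R *: 'X.
  have c0 : mmap polyC c Q = 0.
    by apply: poly_eq_horner => y; rewrite horner_mmap hQ horner0.
  have := deriv_mmap c Q; rewrite c0 deriv0 => /(congr1 (horner^~ 0)).
  rewrite horner0 horner_sum (bigD1 k) //= big1 => [|i /negbTE nik].
    rewrite addr0 hornerM horner_mmap {2}/c derivD derivC add0r eqxx derivZ derivX.
    rewrite scale1r hornerC mulr1 => ->; apply: meval_eq => i.
    by rewrite /c !hornerE.
  by rewrite /c nik scale0r addr0 derivC mulr0 horner0.
move=> hP; apply/mpolyP => m; rewrite mcoeff0.
elim: (mdeg m) {-2}m (erefl (mdeg m)) P hP => {m} [|e IHe] m em P hP.
  have -> : m = 0%MM by apply/eqP; rewrite -mdeg_eq0 em.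
  rewrite -(hP (fun _ => 0)) {1}(mpolyE P) mevalE raddf_sum; apply: eq_bigr => m' _.
  rewrite /= mcoeffZ mcoeffX; congr (_ * _); case: eqP => [->|/eqP nm].
    by rewrite big1 // => i _; rewrite mnm0E.
  have [i ni] : exists i, m' i != 0%N.
    apply/existsP; apply: contraNT nm; rewrite negb_exists => /forallP h.
    by apply/eqP/mnmP => i; rewrite mnm0E; apply/eqP; have := h i; rewrite negbK.
  by rewrite (bigD1 i) //= expr0n (negbTE ni) mul0r.
have [i ni] : exists i, m i != 0%N.
  apply/existsP; apply: contraPT em; rewrite negb_exists => /forallP h.
  have -> : m = 0%MM by apply/mnmP => i; rewrite mnm0E; apply/eqP; have := h i; rewrite negbK.
  by rewrite mdeg0.
have mi : (U_(i) <= m)%MM by rewrite lep1mP.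
have em' : mdeg (m - U_(i)) = e.
  by apply/eqP; rewrite -eqSS -em -{2}(submK mi) mdegD mdeg1 addn1.
have /eqP := IHe _ em' _ (hd P i hP); rewrite mcoeff_deriv submK //.
by rewrite mulrn_eq0 => /eqP.
Qed.

(** * Orbits of the root subgroups as polynomial curves *)

Section RootCurves.
Variables (K : numFieldType) (d : nat) (b : bool).
Implicit Types (x : 'I_d.+3 -> K) (k : 'I_d.+3).

Definition dehom_pt x : {poly K} := \poly_(e < d.+1) x (inord (rexp d b e)).

(* The orbit of the point [x] under the one-parameter root subgroup; on the
   dehomogenized form p the subgroup acts by p(X) -> p(X - s), whose coefficients
   are Taylor coefficients of p at -s. *)
Definition root_curve x k : {poly K} :=
  if (k < d.+1)%N then (dehom_pt x)^`N(rexp d b k) \Po (- 'X)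
  else (x k)%:P + ((k == d.+1 + b :> nat)%N%:R * x (inord (d.+2 - b))) *: 'X.

Lemma eq_root_curve x y k : x =1 y -> root_curve x k = root_curve y k.
Proof.
move=> e; rewrite /root_curve !e; congr (if _ then _^`N(_) \Po _ else _).
by apply/polyP => i; rewrite !coef_poly e.
Qed.

Lemma rexpK k : (k < d.+1)%N -> rexp d b (rexp d b k) = k.
Proof. by rewrite /rexp; case: b => //; rewrite ltnS => /subKn. Qed.

Lemma rexp_lt k : (k < d.+1)%N -> (rexp d b k < d.+1)%N.
Proof. by rewrite /rexp; case: b; lia. Qed.

Lemma root_curve0 x k : (root_curve x k).[0] = x k.
Proof.
rewrite /root_curve; case: ltnP => hk; last by rewrite !hornerE.
rewrite horner_comp hornerN hornerX oppr0 horner_coef0 coef_nderivn addn0 binn mulr1n.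
have hr := rexp_lt hk.
by rewrite coef_poly hr rexpK // inord_val.
Qed.

(** The curve is an integral curve of the root field; on the form coordinates this is
    [deriv_nderivn], the sign coming from the substitution of -X. *)
Lemma deriv_root_curve x k :
  (root_curve x k)^`() = rcoef K b k *: root_curve x (rnext b k).
Proof.
rewrite /root_curve /rcoef; case: ltnP => hk.
  rewrite deriv_comp derivN derivX mulrN1 deriv_nderivn.
  have hr := rexp_lt hk; case: ifP => hr'.
    have nz : rcoef K b k != 0 by rewrite /rcoef hk hr' oppr_eq0 pnatr_eq0.
    have e : rexp d b (rnext b k) = (rexp d b k).+1.
      by rewrite (val_rnext nz) hk; move: hr' hk; rewrite /rexp; case: b; lia.
    rewrite ifT; last by rewrite (val_rnext nz) hk; move: hr' hk; rewrite /rexp; case: b; lia.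
    by rewrite e raddfMn scaleNr scaler_nat.
  rewrite scale0r nderivn_poly0 ?mul0rn ?comp_poly0 ?oppr0 //.
  by apply: leq_trans (size_poly _ _) _; lia.
rewrite derivD derivC add0r derivZ derivX alg_polyC.
case: eqP => [e|ne]; last by rewrite mul0r scale0r.
have nz : rcoef K b k != 0 by rewrite /rcoef ltnNge hk /= e eqxx oner_eq0.
have e' : rnext b k = (d.+2 - b)%N :> nat by rewrite (val_rnext nz) ltnNge hk.
rewrite e' ifF; last by case: b; lia.
rewrite (_ : (_ == _) = false); last by case: b; lia.
rewrite mul0r scale0r addr0 mul1r scale1r; congr (x _)%:P.
by apply: val_inj; rewrite /= e' inordK //; case: b; lia.
Qed.

Lemma deriv_mmap_root_curve x P :
  (mmap polyC (root_curve x) P)^`() =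
  mmap polyC (root_curve x) (vfield (@rcoef K d b) (@rnext d b) P).
Proof.
rewrite deriv_mmap /vfield rmorph_sum; apply: eq_bigr => k _ /=.
rewrite deriv_root_curve mmapZ rmorphM /= mmapX mmap1U -scalerAr mul_polyC.
by rewrite [_ * mmap _ _ _]mulrC.
Qed.

(** The derivative of P along a curve is the value of the root field applied to P; if it is zero, P
    is constant there. Conversely, evaluating the derivative at 0 recovers the field at the
    arbitrary point x. *)
Lemma root_curve_invariant P :
  vfield (@rcoef K d b) (@rnext d b) P = 0 <->
  (forall x s, P.@[fun k => (root_curve x k).[s]] = P.@[x]).
Proof.
have ev0 Q x : (mmap polyC (root_curve x) Q).[0] = Q.@[x].
  by rewrite horner_mmap; apply: meval_eq => k; rewrite root_curve0.
split=> [h x s|h].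
  rewrite -(horner_mmap (root_curve x)) -(ev0 P x); apply: deriv_eq0.
  by rewrite deriv_mmap_root_curve h rmorph0.
apply: mpoly_eq0_meval => x; rewrite -ev0 -deriv_mmap_root_curve.
suff -> : mmap polyC (root_curve x) P = P.@[x]%:P by rewrite derivC horner0.
by apply: poly_eq_horner => s; rewrite horner_mmap h hornerC.
Qed.

End RootCurves.

(** * Root subgroups of SL(2) acting on forms *)

Definition ob (b : bool) : 'I_2 := if b then 1 else 0.

Lemma ord2_cases (r : 'I_2) b : r = ob b \/ r = ob (~~ b).
Proof. by case: r => [[|[|r]] hr] //; case: b; [right|left|left|right]; apply: val_inj. Qed.

Lemma ob_neq b : (ob (~~ b) == ob b) = false.
Proof. by case: b. Qed.

Lemma big_ob (T : Type) (idx : T) (op : Monoid.com_law idx) b (f : 'I_2 -> T) :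
  \big[op/idx]_(r < 2) f r = op (f (ob b)) (f (ob (~~ b))).
Proof.
rewrite (bigD1 (ob b)) //= (bigD1 (ob (~~ b))) ?ob_neq //= big1 ?Monoid.mulm1 // => r.
by case: (ord2_cases r b) => ->; rewrite eqxx ?andbF.
Qed.

Definition root_mx (K : comNzRingType) b (s : K) : 'M[K]_2 :=
  1%:M + s *: delta_mx (ob b) (ob (~~ b)).

Lemma root_mxE (K : comNzRingType) b (s : K) r t :
  root_mx b s r t = (r == t)%:R + s * ((r == ob b) && (t == ob (~~ b)))%:R.
Proof. by rewrite !mxE. Qed.

Lemma root_mxM (K : comNzRingType) b (s t : K) :
  root_mx b s *m root_mx b t = root_mx b (s + t).
Proof.
rewrite /root_mx mulmxDl mul1mx mulmxDr mulmx1 -scalemxAl -scalemxAr.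
by rewrite mul_delta_mx_0 ?ob_neq // !scaler0 addr0 -addrA -scalerDl [t + s]addrC.
Qed.

Lemma root_mx0 (K : comNzRingType) b : root_mx b (0 : K) = 1%:M.
Proof. by rewrite /root_mx scale0r addr0. Qed.

Lemma root_mx_unit (K : comUnitRingType) b (s : K) : root_mx b s \in unitmx.
Proof. by have := root_mxM b s (- s); rewrite subrr root_mx0 => /mulmx1_unit[]. Qed.

Lemma invmx_root (K : comUnitRingType) b (s : K) : invmx (root_mx b s) = root_mx b (- s).
Proof.
by rewrite -[RHS](mulKmx (root_mx_unit b s)) root_mxM subrr root_mx0 mulmx1.
Qed.

Section BinaryForms.
Variables (d : nat).
Implicit Types (f : {mpoly C[2]}) (b : bool).

Definition dehom b f : {poly C} :=
  mmap polyC (fun r : 'I_2 => if r == ob b then 'X else 1) f.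

Lemma mdeg_ob b (m : 'X_{1..2}) : mdeg m = (m (ob b) + m (ob (~~ b)))%N.
Proof. by rewrite mdegE (big_ob _ b). Qed.

Lemma mon_ob b e : (e <= d)%N -> mon d (rexp d b e) (ob b) = e.
Proof. by move=> he; rewrite mnmE; case: b => //=; rewrite /rexp subKn. Qed.

Lemma mdeg_mon k : (k <= d)%N -> mdeg (mon d k) = d.
Proof. by move=> hk; rewrite (mdeg_ob false) !mnmE /= subnK. Qed.

Lemma rexp_le b e : (e <= d)%N -> (rexp d b e <= d)%N.
Proof. by case: b => //= _; apply: leq_subr. Qed.

Lemma eq_mon b e (m : 'X_{1..2}) : (e <= d)%N -> mdeg m = d ->
  (m == mon d (rexp d b e)) = (m (ob b) == e).
Proof.
move=> he hm; apply/eqP/eqP => [->|hb]; first exact: mon_ob.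
have h2 := mdeg_mon (rexp_le b he).
apply/mnmP => r; move: hm h2; rewrite !(mdeg_ob b) mon_ob // hb.
by case: (ord2_cases r b) => ->; rewrite ?mon_ob //; lia.
Qed.

Lemma coef_dehom b f e : f \is d.-homog ->
  (dehom b f)`_e = if (e < d.+1)%N then f@_(mon d (rexp d b e)) else 0.
Proof.
move=> /dhomogP hf; rewrite /dehom /mmap coef_sum.
rewrite (eq_bigr (fun m : 'X_{1..2} => f@_m * (m (ob b) == e)%:R)); last first.
  move=> m _; rewrite coefCM /mmap1 (big_ob _ b) /= eqxx ob_neq expr1n mulr1 coefXn.
  by rewrite eq_sym.
rewrite ltnS; case: leqP => he.
  rewrite [in RHS](mpolyE f) raddf_sum /= big_seq [RHS]big_seq.
  by apply: eq_bigr => m hm; rewrite mcoeffZ mcoeffX eq_mon //; apply: hf.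
rewrite big_seq big1 // => m /hf hm; rewrite (_ : (_ == _) = false) ?mulr0 //.
by apply/negP => /eqP h; move: hm; rewrite /= (mdeg_ob b) h; lia.
Qed.

Lemma dehom_ptE b f u : f \is d.-homog -> dehom_pt b (pt d f u) = dehom b f.
Proof.
move=> hf; apply/polyP => e; rewrite coef_dehom // coef_poly; case: ifP => // he.
have hr : (rexp d b e < d.+1)%N by rewrite ltnS rexp_le.
by rewrite /pt inordK ?hr //; lia.
Qed.

Lemma tnth_inv_subst (g : 'M[C]_2) r :
  tnth (inv_subst g) r = \sum_(s < 2) (invmx g) r s *: 'X_s.
Proof. by rewrite tnth_mktuple. Qed.

Lemma act_form_homog g f : f \is d.-homog -> act_form g f \is d.-homog.
Proof.
move=> /dhomogP hf; rewrite /act_form comp_mpolyEX big_seq rpred_sum // => m /hf <-.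
rewrite rpredZ // comp_mpolyX (big_ob _ false) /= (mdeg_ob false).
have hl r : tnth (inv_subst g) r \is 1.-homog.
  rewrite tnth_inv_subst rpred_sum // => s _; rewrite rpredZ // dhomogX.
  by rewrite /= mdeg1.
by apply: dhomogM; rewrite -[X in X.-homog]mul1n; apply: dhomogMn.
Qed.

Lemma mmap_comp (S : comNzRingType) (h : 'I_2 -> S) (phi : {rmorphism C -> S})
    f (q : 2.-tuple {mpoly C[2]}) :
  mmap phi h (f \mPo q) = mmap phi (fun r => mmap phi h (tnth q r)) f.
Proof.
by rewrite /comp_mpoly rmorph_mmap; apply: eq_mmap => // c /=; rewrite mmapC.
Qed.

(** The inverse root matrix replaces the moved variable by itself minus s times the other, which
    dehomogenisation sets to 1. *)
Lemma dehom_act b s f : dehom b (act_form (root_mx b s) f) = dehom b f \Po ('X - s%:P).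
Proof.
rewrite /dehom /act_form mmap_comp -[RHS]/(comp_poly _ _) rmorph_mmap.
apply: eq_mmap => [c|r] /=; first by rewrite comp_polyC.
rewrite tnth_inv_subst invmx_root (big_ob _ b) rmorphD /= !mmapZ !mmapX !mmap1U.
rewrite !root_mxE eqxx ob_neq !eqxx andbT.
case: (ord2_cases r b) => ->; rewrite ?eqxx ?ob_neq ?[ob b == ob (~~ b)]eq_sym ?ob_neq /=.
  by rewrite comp_polyX ?andbF !(mulr0, addr0, mulr1, add0r, mul1r) polyCN.
by rewrite ?comp_poly1 ?comp_polyC !(mulr0, addr0, mulr1, add0r, mul1r, mul0r).
Qed.

Lemma pt_u b f u (k : 'I_d.+3) : k = (d.+1 + b)%N :> nat -> pt d f u k = u (ob b) 0.
Proof.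
move=> e; rewrite /pt e ltnNge leq_addr /= -[X in (_ == X)%N]addn0 eqn_add2l.
by case: b {e}.
Qed.

(** On form coordinates this is [dehom_act] with Taylor's formula; on u, only the entry [ob b]
    moves, by s times the other entry. *)
Lemma pt_root b s f u k : f \is d.-homog ->
  pt d (act_form (root_mx b s) f) (root_mx b s *m u) k = (root_curve b (pt d f u) k).[s].
Proof.
move=> hf; rewrite /root_curve {1}/pt; case: ltnP => hk.
  rewrite horner_comp hornerN hornerX dehom_ptE // -coef_comp_XsubC -dehom_act.
  rewrite coef_dehom ?act_form_homog //.
  have hr := rexp_lt b hk; rewrite hr (rexpK _ hk) //.
have -> : (if k == d.+1 :> nat then (root_mx b s *m u) 0 0 else (root_mx b s *m u) 1 0)
    = pt d (act_form (root_mx b s) f) (root_mx b s *m u) k by rewrite /pt ltnNge hk.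
have mulE r : (root_mx b s *m u) r 0 =
    u r 0 + (r == ob b)%:R * s * u (ob (~~ b)) 0.
  rewrite /root_mx mulmxDl mul1mx -scalemxAl !mxE (big_ob _ (~~ b)) !mxE eqxx negbK.
  rewrite [ob b == _]eq_sym ob_neq andbT andbF /= mul0r addr0.
  by rewrite mulrA [s * _]mulrC.
have hu b' : (inord (d.+1 + b') : 'I_d.+3) = (d.+1 + b')%N :> nat.
  by rewrite inordK //; case: b'; rewrite ?addn0 ?addn1.
have [e|e] : k = (d.+1 + b)%N :> nat \/ k = (d.+1 + ~~ b)%N :> nat.
  by have := ltn_ord k; case: (b) => /=; lia.
  rewrite (pt_u _ _ e) mulE eqxx e eqxx (pt_u _ _ e) mul1r !hornerE.
  have -> : (d.+2 - b = d.+1 + ~~ b)%N by case: (b); rewrite ?subn0 ?addn0 ?addn1 ?subn1.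
  by rewrite (pt_u _ _ (hu _)) mulrC.
rewrite (pt_u _ _ e) mulE ob_neq e eqn_add2l (pt_u _ _ e) !hornerE.
by case: (b); rewrite !mul0r ?addr0.
Qed.
End BinaryForms.

(** * Invariants and the theorem *)

Lemma matrix2P (K : Type) (A B : 'M[K]_2) :
  A 0 0 = B 0 0 -> A 0 1 = B 0 1 -> A 1 0 = B 1 0 -> A 1 1 = B 1 1 -> A = B.
Proof.
move=> h1 h2 h3 h4; apply/matrixP => r t.
by case: (ord2_cases r true) => ->; case: (ord2_cases t true) => ->.
Qed.

Lemma det_mx2 (K : comNzRingType) (A : 'M[K]_2) :
  \det A = A 0 0 * A 1 1 - A 0 1 * A 1 0.
Proof.
rewrite (expand_det_row _ 0) (big_ob _ false) /= /cofactor !det_mx11 !mxE /=.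
rewrite expr0 mul1r expr1 mulN1r mulrN.
by congr (_ * A _ _ - _ * A _ _); apply: val_inj.
Qed.

(** SL(2) is generated by its root subgroups: if the lower left entry is nonzero, g factors as
    upper, lower, upper; otherwise a lower root matrix on the left first makes that entry
    nonzero. *)
Lemma SL2_ind (K : fieldType) (Q : 'M[K]_2 -> Prop) :
  (forall b s, Q (root_mx b s)) ->
  (forall g h, g \in unitmx -> h \in unitmx -> Q g -> Q h -> Q (g *m h)) ->
  forall g, \det g = 1 -> Q g.
Proof.
move=> Qr Qm.
have Qc g : \det g = 1 -> g 1 0 != 0 -> Q g.
  move=> dg nz; have e : g = root_mx false ((g 0 0 - 1) / g 1 0) *m
     (root_mx true (g 1 0) *m root_mx false ((g 1 1 - 1) / g 1 0)).
    move: dg; rewrite det_mx2 => dg.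
    have d1 : g 0 1 = (g 0 0 * g 1 1 - 1) / g 1 0.
      by apply: (canRL (mulfK nz)); rewrite -dg opprB addrC subrK.
    apply: matrix2P; rewrite ?d1; do ?(rewrite !mxE !(big_ob _ false) /=);
      rewrite !mxE ?(big_ob _ false) /= ?mxE /=; field => //.
  rewrite e; apply: (Qm); rewrite ?unitmx_mul ?root_mx_unit //.
  by apply: Qm; rewrite ?root_mx_unit.
move=> g dg; have [g10|] := eqVneq (g 1 0) 0; last exact: Qc.
have e : g = root_mx true (-1) *m (root_mx true 1 *m g).
  by rewrite mulmxA root_mxM addNr root_mx0 mul1mx.
rewrite e; apply: Qm => //; rewrite ?unitmx_mul ?root_mx_unit //.
  by rewrite unitmxE dg unitr1.
have d1 : \det (root_mx true (1 : K)) = 1.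
  by rewrite det_mx2 !mxE /=; ring.
apply: Qc; first by rewrite det_mulmx d1 dg mulr1.
(* The new lower left entry is [g 0 0], nonzero because g has determinant 1 and [g 1 0] is 0. *)
rewrite !mxE (big_ob _ false) !mxE /= g10 mulr0 addr0 add0r !mul1r.
apply/eqP => g00; move: dg; rewrite det_mx2 g10 g00 !(mul0r, mulr0) subrr => /esym/eqP.
by rewrite oner_eq0.
Qed.

Lemma act_formM (g h : 'M[C]_2) f : g \in unitmx -> h \in unitmx ->
  act_form (g *m h) f = act_form g (act_form h f).
Proof.
move=> ug uh; rewrite /act_form [RHS]mmap_comp; apply: eq_mmap => // r.
rewrite !tnth_inv_subst rmorph_sum (_ : invmx (g *m h) = invmx h *m invmx g); last exact: invrM.
under [RHS]eq_bigr => t _ do rewrite /= mmapZ mmapX mmap1U tnth_inv_subst mulr_sumr.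
rewrite exchange_big /=; apply: eq_bigr => s _; rewrite mxE scaler_suml.
by apply: eq_bigr => t _; rewrite mul_mpolyC scalerA.
Qed.

Section Covariants.
Variables (d : nat).
Implicit Types (P : {mpoly C[d.+3]}) (x : 'I_d.+3 -> C).

Lemma pt_surj x : exists f u, f \is d.-homog /\ x =1 pt d f u.
Proof.
exists (\sum_(k < d.+1) x (inord k) *: 'X_[mon d k]).
exists (\col_r x (inord (d.+1 + r))); split.
  by rewrite rpred_sum // => k _; rewrite rpredZ // dhomogX /= mdeg_mon // -ltnS.
move=> k; rewrite /pt; case: ltnP => hk.
  rewrite raddf_sum (bigD1 (Ordinal hk)) //= mcoeffZ mcoeffX eqxx mulr1 inord_val.
  rewrite big1 ?addr0 // => l /eqP nl; rewrite mcoeffZ mcoeffX.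
  case: eqP => [/mnmP/(_ (ob true))|]; last by rewrite mulr0.
  by rewrite !mnmE /= => e; case: nl; apply: val_inj.
rewrite !mxE; have := ltn_ord k; case: eqP => [e|ne] hk'; congr x; apply: val_inj;
  rewrite /= inordK /=; lia.
Qed.

(** The root subgroups generate SL(2) and move points along root curves, so [root_curve_invariant]
    applies; [pt_surj] supplies a form and a vector for every point. *)
Lemma is_invariantP P : is_invariant d P <->
  forall b, vfield (@rcoef C d b) (@rnext d b) P = 0.
Proof.
split=> [h b|h].
  apply/root_curve_invariant => x s; have [f [u [hf hx]]] := pt_surj x.
  rewrite (meval_eq _ hx) -(h (root_mx b s)) //.
    apply: meval_eq => k; rewrite pt_root //.
    by congr (_.[s]); apply: eq_root_curve.
  by rewrite det_mx2 !mxE; case: b => /=; ring.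
apply: SL2_ind => [b s f hf u|g g' ug ug' hg hg' f hf u].
  have /root_curve_invariant e := h b; rewrite -[RHS](e _ s).
  by apply: meval_eq => k; apply: pt_root.
by rewrite act_formM // -mulmxA hg ?act_form_homog ?hg'.
Qed.

(** An invariant has weight 0 because H = EF - FE kills it; conversely, in weight 0 being killed by
    E implies being killed by F. *)
Lemma in_covP i j P : in_cov d i j P <->
  {subset msupp P <= wmons d i j 0} /\ vfield (@rcoef C d false) (@rnext d false) P = 0.
Proof.
split=> [[hP /is_invariantP inv]|[hP EP]].
  split; last exact: inv.
  have HP : euler (@wt d) P = 0%:~R *: P.
    by rewrite -fE_fF !inv !linear0 addr0 scale0r.
  move=> m hm; apply/mem_wmons; have [? ?] := hP m hm; split=> //.
  exact: (euler_eigen _ _ _).1 HP m hm.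
split; first by move=> m /hP /mem_wmons[].
apply/is_invariantP => -[]; last exact: EP.
exact: wspace0_invariant hP EP.
Qed.
End Covariants.

Lemma eq_has_basis n (S T : {mpoly C[n]} -> Prop) N :
  (forall P, S P <-> T P) -> has_basis n S N -> has_basis n T N.
Proof.
move=> h [B [h1 h2 h3]]; exists B; split=> // [k|P /h]; last exact: h3.
by apply/h.
Qed.

Local Close Scope ring_scope.

(* P_d(z,t) = RHS, coefficientwise: for all i j, dim (C_d)_{i,j} equals the
   coefficient of z^i t^j of the right-hand side. *)
Theorem theorem3 (d : nat) (hd : (1 <= d)%N) (i j : nat) :
  exists N : nat, dim_cov d i j N /\ (N%:Z = rhs d i j)%R.
Proof.
(* The covariants are the kernel of E from weight 0 to weight 2; F goes back, and [fE_fF_inj] gives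
   the injectivity of E F on weight 2. *)
have [|||le hb] := @has_basis_kernel _ (wmons d i j 0) (wmons d i j 2)
    (vfield (@rcoef C d false) (@rnext d false)) (vfield (@rcoef C d true) (@rnext d true))
    (uniq_wmons _ _ _ _) (uniq_wmons _ _ _ _).
- by move=> P /(@wspace_vfield C d false).
- by move=> P /(@wspace_vfield C d true).
- by move=> P; apply: fE_fF_inj.
exists (size (wmons d i j 0) - size (wmons d i j 2)); split.
  by apply: eq_has_basis hb => P; rewrite in_covP.
by rewrite rhs_wmons // -subzn.
Qed.
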